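(* Let $S\subset\mathbb{N}^*$ be a Sidon set such that $\sum_{s\in S}\frac1s=\max\big\{\sum_{s\in S'}\frac1s : S'\subset\mathbb{N}^*\text{ a Sidon set}\big\}$. Then there exists a constant $C>0.257$ such that $|S\cap\{1,\dots,n\}|>Cn^{1/4}$ for all $n\in\mathbb{N}^*$. Moreover, $$\limsup_{n\to\infty}\frac{|S\cap\{1,\dots,n\}|}{n^{1/3}}>0.$$
   Context: A Sidon set is a set $S$ of positive integers such that all the sums $s+s'$ with $s,s'\in S$, $s\le s'$, are distinct. $\mathbb{N}^*=\{1,2,3,\dots\}$. *)

(* Defs.v *)
From mathcomp Require Import all_boot all_order all_algebra finmap.
From mathcomp Require Import all_classical all_reals all_analysis.

Set Implicit Arguments.
Unset Strict Implicit.
Unset Printing Implicit Defensive.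

Import Order.TTheory GRing.Theory Num.Theory.

Local Open Scope classical_set_scope.
Local Open Scope ring_scope.

Definition Sidon (S : set nat) : Prop :=
  S `<=` [set s | (0 < s)%N] /\
  forall a b c d : nat, S a -> S b -> S c -> S d ->
    (a <= b)%N -> (c <= d)%N -> (a + b = c + d)%N -> a = c /\ b = d.

(* Extended-real valued: the sum of an arbitrary family of nonnegative terms,
   so that no summability is presupposed. *)
Definition reciprocal_sum (R : realType) (S : set nat) : \bar R :=
  \esum_(s in S) ((s%:R : R)^-1)%:E.

Definition is_max (R : realType) (A : set (\bar R)) (m : \bar R) : Prop :=
  A m /\ ubound A m.

Definition counting_fun (S : set nat) (n : nat) : nat :=
  #|` fset_set (S `&` [set k | (1 <= k <= n)%N]) |.

(* Main.v *)
(* A Sidon set of [j] elements can be extended by some [m <= j^3 + j^2 + 1].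
   Replacing the elements of a maximal [S] above [n] by this greedy continuation
   of its first [k = |S `&` [1, n]|] elements cannot increase the sum, so the
   tail of [S] above [n] has sum at least
   [\sum_(j >= k) 1 / (j (j + 1) (j + 2)) = 1 / (2 k (k + 1))].
   Counting differences bounds that tail above by [O(n^(-1/2))], so [k] is at
   least of order [n^(1/4)].  If the counting function were at most
   [m^(1/3) / 2] for all large [m], the tail would be at most
   [1 / (16 k (k + 1))], a contradiction. *)
Require Import Defs.
From mathcomp Require Import all_boot all_order all_algebra finmap.
From mathcomp Require Import zify ring lra.
From mathcomp Require Import all_classical all_reals all_analysis.
Import Order.TTheory GRing.Theory Num.Theory.
Local Open Scope classical_set_scope.
Local Open Scope ring_scope.

(** * Finite Sidon sets: distinct differences and one-point extensions *)

Lemma Sidon_sub (S T : set nat) : T `<=` S -> Sidon S -> Sidon T.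
Proof.
move=> TS [Spos Sinj]; split=> [x /TS/Spos //|a b c d Ta Tb Tc Td].
by apply: Sinj; apply: TS.
Qed.

(** Equal sums force [{a, d} = {c, b}] as multisets, and [a <> b] rules out the crossed matching.
    This is injectivity of nonzero differences, written without subtraction. *)
Lemma Sidon_diff (S : set nat) (a b c d : nat) : Sidon S ->
  S a -> S b -> S c -> S d -> a <> b -> (a + d = c + b)%N -> a = c /\ b = d.
Proof.
move=> [_ Sinj] Sa Sb Sc Sd ab e.
have [ad|da] := leqP a d; have [cb|bc] := leqP c b.
- by have [] := Sinj _ _ _ _ Sa Sd Sc Sb ad cb e; lia.
- by have [] := Sinj _ _ _ _ Sa Sd Sb Sc ad (ltnW bc) ltac:(lia); lia.
- by have [] := Sinj _ _ _ _ Sd Sa Sc Sb (ltnW da) cb ltac:(lia); lia.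
- by have [] := Sinj _ _ _ _ Sd Sa Sb Sc (ltnW da) (ltnW bc) ltac:(lia); lia.
Qed.

Lemma Sidon_size_interval (X : seq nat) (l M : nat) : Sidon [set` X] ->
  uniq X -> M \in X -> {in X, forall x, (l <= x <= M)%N} ->
  (size X * (size X).-1 + 2 * l <= 2 * M)%N.
Proof.
move=> XS uX MX Xb.
(* Differences over ordered pairs, shifted by [M] so that truncated subtraction is exact. The value
   [M], consed on below, stands for the difference 0; all values lie in [[l, 2 M - l]]. *)
pose L := [seq (a + M - b)%N | a <- X, b <- rem a X].
have memrem a b : b \in rem a X -> b \in X /\ b <> a.
  by rewrite mem_rem_uniq // inE => /andP[/eqP].
have sL : size L = (size X * (size X).-1)%N.
  rewrite /L size_allpairs_dep.
  have -> : [seq size (rem a X) | a <- X] = [seq (size X).-1 | a <- X].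
    by apply/eq_in_map => a aX; rewrite size_rem.
  by rewrite sumnE big_map big_const_seq count_predT iter_addn_0 mulnC.
have uL : uniq (M :: L).
  rewrite /= allpairs_uniq_dep ?andbT //.
  - apply/negP => /allpairsPdep[a [b [aX /memrem[bX ba]]]].
    by move: (Xb _ aX) (Xb _ bX); lia.
  - by move=> a _; apply: rem_uniq.
  move=> p q /allpairsPdep[a [b [aX /memrem[bX ba] ->]]].
  move=> /allpairsPdep[c [d [cX /memrem[dX dc] ->]]] /= e.
  have [| |-> -> //] := @Sidon_diff [set` X] a b c d XS aX bX cX dX.
    by move=> ab; apply: ba.
  by move: (Xb _ aX) (Xb _ bX) (Xb _ cX) (Xb _ dX); lia.
have : {subset M :: L <= iota l (2 * (M - l)).+1}.
  move=> y; rewrite inE => /orP[/eqP ->|/allpairsPdep[a [b [aX /memrem[bX _] ->]]]].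
    by rewrite mem_iota; move: (Xb _ MX); lia.
  by rewrite mem_iota; move: (Xb _ aX) (Xb _ bX); lia.
move=> /(uniq_leq_size uL); rewrite size_iota /= sL.
by move: (Xb _ MX); lia.
Qed.

(* The new element avoids every [a + b - c] and every [(a + b) / 2] with
   [a], [b], [c] in [X]; the case [b = c] also keeps it out of [X]. *)
Lemma Sidon_extend (X : seq nat) : Sidon [set` X] ->
  exists m, [/\ (0 < m <= size X ^ 3 + size X ^ 2 + 1)%N, m \notin X &
                Sidon [set` m :: X]].
Proof.
move=> XS.
pose D := [seq (p - c)%N | p <- [seq (a + b)%N | a <- X, b <- X], c <- X].
pose H := [seq (a + b)./2 | a <- X, b <- X].
have sF : size (D ++ H) = (size X ^ 3 + size X ^ 2)%N.
  by rewrite size_cat !size_allpairs; lia.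
(* Pigeonhole: there is one more candidate than entries in the forbidden list. Truncation in [D] and
   rounding in [H] can only forbid extra values. *)
have [m mI mF] : exists2 m, m \in iota 1 (size (D ++ H)).+1 & m \notin D ++ H.
  apply/hasP; rewrite has_predC; apply/negP => /allP sub.
  by have := uniq_leq_size (iota_uniq _ _) sub; rewrite size_iota ltnn.
move: mI; rewrite sF mem_iota => mI.
move: mF; rewrite mem_cat negb_or => /andP[mD mH].
have f3 a b c : a \in X -> b \in X -> c \in X -> (m + c <> a + b)%N.
  move=> aX bX cX e; move/negP: mD; apply; apply/allpairsP.
  exists ((a + b)%N, c); split=> //=; last by lia.
  by apply/allpairsP; exists (a, b).
have f2 a b : a \in X -> b \in X -> (m + m <> a + b)%N.
  move=> aX bX e; move/negP: mH; apply; apply/allpairsP.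
  by exists (a, b); split=> //=; lia.
have mX : m \notin X by apply/negP => mX; apply: (f3 m m m).
exists m; split=> //; first by lia.
case: XS => Xpos Xinj; split=> [x /=|a b c d /=].
  by rewrite inE => /orP[/eqP -> |/Xpos //]; lia.
rewrite !inE => /orP[/eqP -> |aX] /orP[/eqP -> |bX] /orP[/eqP -> |cX]
  /orP[/eqP -> |dX] ab cd e; try lia.
- by have := f2 _ _ cX dX; lia.
- by have := f3 _ _ _ cX dX bX; lia.
- by have := f3 _ _ _ cX dX aX; lia.
- by have := f2 _ _ aX bX; lia.
- by have := f3 _ _ _ aX bX dX; lia.
- by have := f3 _ _ _ aX bX cX; lia.
- exact: Xinj.
Qed.

(** * Finite reciprocal sums and greedy continuations *)

Definition rsum (R : realType) (X : seq nat) : R := \sum_(x <- X) x%:R^-1.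

Lemma reciprocal_sum_seq (R : realType) (X : seq nat) : uniq X ->
  reciprocal_sum R [set` X] = (rsum R X)%:E.
Proof.
move=> uX; rewrite /reciprocal_sum esum_fset; [|exact: finite_seq|].
  by rewrite fsumEFin; [rewrite /rsum (fsbig_seq _ _ uX)|exact: finite_seq].
by move=> i _; rewrite lee_fin invr_ge0 ler0n.
Qed.

Lemma reciprocal_sum_le (R : realType) (S : set nat) (B : R) :
  (forall X, uniq X -> [set` X] `<=` S -> rsum R X <= B) ->
  (reciprocal_sum R S <= B%:E)%E.
Proof.
move=> XB; apply: ge_ereal_sup => _ [A [finA AS] <-].
rewrite fsumEFin // lee_fin fsbig_finite //=.
apply: XB; first exact: fset_uniq.
by rewrite fset_setK.
Qed.

(* [1 / (2 j (j + 1))] is the sum of [1 / (i (i + 1) (i + 2))] over [i >= j]. *)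
Definition tail3 (R : realType) (j : nat) : R := (2 * j%:R * (j%:R + 1))^-1.

Lemma tail3_step (R : realType) (j : nat) : (0 < j)%N ->
  tail3 R j - tail3 R j.+1 = (j%:R * (j%:R + 1) * (j%:R + 2))^-1.
Proof.
move=> j0; rewrite /tail3 -[j.+1]addn1 natrD.
have : 0 < j%:R :> R by rewrite ltr0n.
move: (j%:R : R) => x x0; field; lra.
Qed.

Lemma Sidon_greedy (R : realType) (X : seq nat) (N : nat) :
  Sidon [set` X] -> uniq X -> (0 < size X)%N ->
  exists Y, [/\ Sidon [set` Y], uniq Y, size Y = (size X + N)%N &
    rsum R X + (tail3 R (size X) - tail3 R (size X + N)) <= rsum R Y].
Proof.
move=> XS uX X0; elim: N => [|N [Y [YS uY sY rY]]].
  by exists X; rewrite addn0 subrr addr0.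
have [m [/andP[m0 mle] mY mS]] := Sidon_extend _ YS.
exists (m :: Y); split=> //=; [by rewrite mY | by rewrite sY addnS|].
rewrite [X in _ <= X]big_cons -/(rsum R Y) addnS -sY.
have Y0 : (0 < size Y)%N by rewrite sY; lia.
have := tail3_step R _ Y0.
(* With [j = size Y >= 1], [m <= j^3 + j^2 + 1 <= j (j + 1) (j + 2)], so the gain covers one
   telescoping step of [tail3]. *)
suff : ((size Y)%:R * ((size Y)%:R + 1) * ((size Y)%:R + 2))^-1 <= m%:R^-1 :> R.
  by move: rY; rewrite -sY; lra.
rewrite lef_pV2 ?posrE; last 2 first.
- by rewrite ?mulr_gt0 ?addr_gt0 ?ltr0n.
- by rewrite ltr0n.
have -> : (size Y)%:R * ((size Y)%:R + 1) * ((size Y)%:R + 2) =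
    (size Y * (size Y + 1) * (size Y + 2))%:R :> R by rewrite !natrM !natrD.
rewrite ler_nat.
move: mle Y0; move: (size Y) => j; rewrite !expnS !expn0; nia.
Qed.

(** * Upper bounds on tails *)

(** Removing maxima one at a time enumerates [X] without sorting it: [f i] has to bound the
    reciprocal of the element with exactly [i] smaller ones. *)
Lemma rsum_le_peel_max (R : realType) (f : nat -> R) (X : seq nat) : uniq X ->
  (forall Y y, uniq Y -> {subset Y <= X} -> y \in Y ->
     {in Y, forall z, (z <= y)%N} -> y%:R^-1 <= f (size Y).-1) ->
  rsum R X <= \sum_(0 <= i < size X) f i.
Proof.
move sX : (size X) => N; elim: N X sX => [|N IH] X sX uX Xf.
  by rewrite (size0nil sX) /rsum big_nil big_geq.
have [x xX xmax] : exists2 x, x \in X & {in X, forall z, (z <= x)%N}.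
  have X0 : exists x, x \in X.
    by case: X sX {IH uX Xf} => // a s _; exists a; rewrite mem_head.
  have Xb z : z \in X -> (z <= \max_(t <- X) t)%N.
    by move=> zX; apply: (@leq_bigmax_seq _ X xpredT id).
  by case: (ex_maxnP X0 Xb) => x xX xmax; exists x.
rewrite big_nat_recr //= /rsum (big_rem x) //= addrC.
apply: lerD; last by have := Xf X x uX (fun _ => id) xX xmax; rewrite sX.
apply: IH; first by rewrite size_rem // sX.
  exact: rem_uniq.
by move=> Y y uY YX; apply: Xf => // z /YX /mem_rem.
Qed.

(* The [i]-th element of [S] above [n] is at least [n + 1 + i (i + 1) / 2]. *)
Lemma Sidon_tail (R : realType) (S : set nat) (n J : nat) (X : seq nat) :
  Sidon S -> (0 < J)%N -> uniq X -> [set` X] `<=` S ->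
  {in X, forall x, (n < x)%N} ->
  rsum R X <= \sum_(0 <= i < J) 2 / (2 * (n%:R + 1) + i%:R * (i%:R + 1))
              + 2 / J%:R.
Proof.
move=> hS J0 uX XS Xn.
pose f i : R := 2 / (2 * (n%:R + 1) + i%:R * (i%:R + 1)).
have f0 i : 0 <= f i.
  by rewrite /f divr_ge0 ?addr_ge0 ?mulr_ge0 ?addr_ge0 ?ler0n.
have Xf : rsum R X <= \sum_(0 <= i < size X) f i.
  apply: rsum_le_peel_max => // Y y uY YX yY ymax.
  have Y0 : (0 < size Y)%N by case: (Y) yY.
  have YS : Sidon [set` Y].
    by apply: Sidon_sub hS => z /YX; apply: XS.
  have Yb : {in Y, forall x, (n.+1 <= x <= y)%N}.
    by move=> z zY; rewrite (ymax z zY) andbT; apply: Xn; apply: YX.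
  have := Sidon_size_interval _ _ _ YS uY yY Yb.
  rewrite -{1}(prednK Y0) /f.
  move: (size Y).-1 => i bnd.
  have y0 : (0 < y)%N by move: (Xn _ (YX _ yY)); lia.
  have yR : 0 < y%:R :> R by rewrite ltr0n.
  rewrite ler_pdivlMr; last first.
    by rewrite ltr_wpDr ?mulr_ge0 ?addr_ge0 ?mulr_gt0 ?ltr_wpDl ?ler0n.
  rewrite ler_pdivrMl //.
  have -> : 2 * (n%:R + 1) + i%:R * (i%:R + 1) =
    (2 * (n + 1) + i * (i + 1))%:R :> R by rewrite !(natrD, natrM).
  by rewrite mulrC -natrM ler_nat; nia.
apply: (le_trans Xf); rewrite -/f.
(* From index [J] on, [f i <= 2 / (i (i + 1)) = 2 / i - 2 / (i + 1)], which telescopes. *)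
have step N : \sum_(0 <= i < J + N) f i <=
    \sum_(0 <= i < J) f i + 2 / J%:R - 2 / (J + N)%:R.
  elim: N => [|N IH]; first by rewrite addn0; lra.
  rewrite addnS big_nat_recr //=.
  suff h : f (J + N)%N <= 2 / (J + N)%:R - 2 / (J + N).+1%:R.
    by rewrite (le_trans (lerD IH h)) // addrA subrK.
  have : 0 < (J + N)%:R :> R by rewrite ltr0n; lia.
  rewrite /f -[(J + N).+1]addn1 (natrD _ (J + N) 1).
  have : 0 <= n%:R :> R by rewrite ler0n.
  move: (n%:R : R) ((J + N)%:R : R) => a x a0 x0.
  have -> : 2 / x - 2 / (x + 1) = 2 / (x * (x + 1)) by field; lra.
  rewrite ler_pM2l // lef_pV2 ?posrE; [nra|nra|nra].
have mono : \sum_(0 <= i < size X) f i <= \sum_(0 <= i < J + size X) f i.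
  rewrite (@big_cat_nat _ _ _ (size X) 0 (J + size X)) ?leq_addl //=.
  by rewrite lerDl sumr_ge0.
have := step (size X).
have : 0 <= 2 / (J + size X)%:R :> R by rewrite divr_ge0 ?ler0n.
lra.
Qed.

(** * Consequences of maximality *)

Lemma counting_fun_size (S : set nat) (X : seq nat) (n : nat) : uniq X ->
  (forall x, x \in X <-> S x /\ (1 <= x <= n)%N) ->
  counting_fun S n = size X.
Proof.
move=> uX Xn; rewrite /counting_fun.
suff -> : S `&` [set k | (1 <= k <= n)%N] = [set` X].
  apply/perm_size/uniq_perm => //.
  move=> x; rewrite in_fset_set; last exact: finite_seq.
  by apply/idP/idP => [/set_mem|xX] //; apply/mem_set.
by apply/seteqP; split=> x /= /Xn.
Qed.

(** The extended sum over [S] is the supremum of its finite subsums, so a bound on these passes to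
    the maximum and then to every competitor. Later arguments need only finite real sums. *)
Lemma rsum_le_of_max (R : realType) (S : set nat) (Y : seq nat) (B : R) :
  is_max [set reciprocal_sum R S' | S' in [set S' | Sidon S']]
         (reciprocal_sum R S) ->
  Sidon [set` Y] -> uniq Y ->
  (forall X, uniq X -> [set` X] `<=` S -> rsum R X <= B) -> rsum R Y <= B.
Proof.
move=> [_ ub] YS uY XB; rewrite -lee_fin -(reciprocal_sum_seq _ _ uY).
by apply: le_trans (reciprocal_sum_le _ _ _ XB); apply: ub; exists [set` Y].
Qed.

(* The first [counting_fun S n] elements of [S] can be continued greedily to a
   Sidon set competing with [S]. *)
Lemma tail3_le_of_max (R : realType) (S : set nat) (n : nat) (b : R) :
  Sidon S ->
  is_max [set reciprocal_sum R S' | S' in [set S' | Sidon S']]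
         (reciprocal_sum R S) ->
  (0 < counting_fun S n)%N ->
  (forall X, uniq X -> [set` X] `<=` S -> {in X, forall x, (n < x)%N} ->
     rsum R X <= b) ->
  tail3 R (counting_fun S n) <= b.
Proof.
move=> hS hmax k0 Xb.
pose A := [seq x <- iota 1 n | `[< S x >]].
have uA : uniq A by rewrite filter_uniq ?iota_uniq.
have AE x : x \in A <-> S x /\ (1 <= x <= n)%N.
  rewrite mem_filter mem_iota add1n ltnS.
  by split=> [/andP[/asboolP]|[/asboolP -> ->]].
clearbody A.
have AS : Sidon [set` A] by apply: Sidon_sub hS => x /AE[].
move: k0; rewrite (counting_fun_size S A n uA AE) => k0.
have XB X : uniq X -> [set` X] `<=` S -> rsum R X <= rsum R A + b.
  move=> uX XS; rewrite /rsum (bigID (fun x => x <= n)%N) /=; apply: lerD.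
    rewrite -big_filter -/(rsum R _).
    have sub : {subset [seq x <- X | (x <= n)%N] <= A}.
      move=> x; rewrite mem_filter => /andP[xn xX]; apply/AE.
      by have Sx := XS _ xX; split=> //; rewrite xn andbT; case: hS => + _; apply.
    rewrite /rsum [leRHS](bigID (mem [seq x <- X | (x <= n)%N])) /=.
    rewrite -[X in _ <= X + _]big_filter.
    rewrite [X in _ <= X + _](perm_big [seq x <- X | (x <= n)%N]) /=.
      by rewrite lerDl sumr_ge0 // => i _; rewrite invr_ge0.
    apply: uniq_perm => [||x]; try by rewrite !filter_uniq.
    rewrite mem_filter /=; apply/andP/idP => [[]//|xX]; split=> //.
    exact: sub.
  rewrite -big_filter; apply: Xb; first exact: filter_uniq.
    by move=> x /=; rewrite mem_filter => /andP[_]; apply: XS.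
  by move=> x; rewrite mem_filter -ltnNge => /andP[].
rewrite leNgt; apply/negP => blt.
(* A finite continuation suffices: after [N.+1] greedy steps the missing part of the tail is at most
   [1 / (N + 1)], less than the assumed gap. *)
have [N Nlt] : exists N : nat, b + N.+1%:R^-1 < tail3 R (size A).
  exact: ltr_add_invr.
have [Y [YS uY _ Ybig]] := Sidon_greedy R A N.+1 AS uA k0.
have := rsum_le_of_max _ _ _ _ hmax YS uY XB.
suff : tail3 R (size A + N.+1) <= N.+1%:R^-1.
  by move: Nlt Ybig; move: (tail3 _ (_ + _)) (N.+1%:R^-1) => u v; lra.
rewrite /tail3 lef_pV2 ?posrE //.
have : 1 <= N.+1%:R :> R by rewrite ler1n.
have : 0 <= (size A)%:R :> R by [].
by rewrite natrD; move: (N.+1%:R) ((size A)%:R) => x y; nra.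
Qed.

(* If [1] is not in [S], then the sum is at most [1/2 + 1/3 + 1/5 + 2/3 = 1.7],
   while the Sidon set [{1, 2, 4}] has sum [1.75]. *)
Lemma one_in_max (R : realType) (S : set nat) : Sidon S ->
  is_max [set reciprocal_sum R S' | S' in [set S' | Sidon S']]
         (reciprocal_sum R S) ->
  S 1%N.
Proof.
move=> hS hmax; apply: contrapT => S1.
have Y124 : Sidon [set` [:: 1%N; 2%N; 4%N]].
  split=> [x /=|a b c d /=]; first by rewrite !inE => /or3P[] /eqP ->.
  by rewrite !inE => /or3P[] /eqP -> /or3P[] /eqP -> /or3P[] /eqP ->
    /or3P[] /eqP ->.
have XB X : uniq X -> [set` X] `<=` S -> rsum R X <= 17 / 10.
  move=> uX XS; have X1 : {in X, forall x, (1 < x)%N}.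
    move=> x /XS Sx; have := hS.1 _ Sx => /= x0.
    by have : x <> 1%N by [move=> x1; apply: S1; rewrite -x1]; lia.
  apply: (le_trans (Sidon_tail R S 1 3 X hS isT uX XS X1)).
  rewrite !big_nat_recr //= big_geq // le_eqVlt.
  by apply/orP; left; apply/eqP; field.
have := rsum_le_of_max _ _ _ _ hmax Y124 isT XB.
by rewrite /rsum !big_cons big_nil; lra.
Qed.

(** * Growth of the counting function *)

Lemma counting_fun_gt0 (S : set nat) (n : nat) : S 1%N -> (0 < n)%N ->
  (0 < counting_fun S n)%N.
Proof.
move=> S1 n0; rewrite cardfs_gt0; apply/fset0Pn; exists 1%N.
rewrite in_fset_set ?inE; first by split.
by apply: (sub_finite_set _ (finite_II n.+1)) => x [_ /andP[_]].
Qed.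

Lemma counting_fun_tail (S : set nat) (n M : nat) (Y : seq nat) :
  (n <= M)%N -> uniq Y -> [set` Y] `<=` S -> {in Y, forall x, (n < x <= M)%N} ->
  (counting_fun S n + size Y <= counting_fun S M)%N.
Proof.
move=> nM uY YS Yb; rewrite /counting_fun.
have fin m : finite_set (S `&` [set k | (1 <= k <= m)%N]).
  by apply: (sub_finite_set _ (finite_II m.+1)) => x [_ /andP[_]].
rewrite -size_cat; apply: uniq_leq_size.
  rewrite cat_uniq fset_uniq uY andbT /=; apply/hasPn => x xY.
  rewrite in_fset_set //; apply/negP => /set_mem[_ /=].
  by move: (Yb _ xY); lia.
move=> x; rewrite mem_cat !in_fset_set // => /orP[/set_mem[Sx /= xn]|xY].
  apply/mem_set; split=> //=.
  by lia.
by apply/mem_set; split; [exact: YS | move: (Yb _ xY) => /=; lia].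
Qed.

(* [218 < (50 / 13) ^ 4], which gives the constant [13 / 50 > 0.257]; the cutoff
   [J = 21 k ^ 2] nearly minimizes [J / (n + 1) + 2 / J] at [n = 218 k ^ 4]. *)
Lemma counting_fun_pow4 (R : realType) (S : set nat) (n : nat) : Sidon S ->
  is_max [set reciprocal_sum R S' | S' in [set S' | Sidon S']]
         (reciprocal_sum R S) ->
  (0 < n)%N -> (n < 218 * counting_fun S n ^ 4)%N.
Proof.
move=> hS hmax n0; rewrite ltnNge; apply/negP => nbig.
have k0 := counting_fun_gt0 S n (one_in_max _ _ hS hmax) n0.
move: nbig k0 (fun b => tail3_le_of_max R S n b hS hmax).
move: (counting_fun S n) => k nbig k0 /(_ _ k0) tail.
have J0 : (0 < 21 * k ^ 2)%N by rewrite muln_gt0 expn_gt0 k0.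
have := tail _ (fun X uX XS Xn => Sidon_tail R S n _ X hS J0 uX XS Xn).
apply/negP; rewrite -ltNge.
have a0 : 0 < n%:R + 1 :> R by rewrite ltr_wpDl.
have : \sum_(0 <= i < 21 * k ^ 2) 2 / (2 * (n%:R + 1) + i%:R * (i%:R + 1))
    <= (21 * k ^ 2)%:R / (n%:R + 1) :> R.
  apply: (@le_trans _ _ (\sum_(0 <= i < 21 * k ^ 2) (n%:R + 1)^-1)).
    apply: ler_sum => i _; have : 0 <= i%:R :> R by [].
    move: (n%:R + 1) (i%:R : R) a0 => a x a0 x0.
    by rewrite ler_pdivrMr ?ler_pdivlMl //; nra.
  by rewrite sumr_const_nat subn0 -[leLHS]mulr_natl.
have : (218 * k ^ 4)%:R <= n%:R + 1 :> R.
  by rewrite (@le_trans _ _ n%:R) ?ler_nat ?lerDl.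
rewrite /tail3 !(natrX, natrM).
have : 1 <= k%:R :> R by rewrite ler1n.
move: (n%:R + 1) (k%:R : R) a0 => a x a0 x1 xa sumle.
have x2 : 0 < x ^+ 2 by rewrite exprn_gt0 //; lra.
have q0 : 0 < (x ^+ 2)^-1 by rewrite invr_gt0.
(* In units of [1 / k^2], the greedy tail is at least [1 / 4], whereas the upper bound is at most
   [21 / 218 + 2 / 21 < 1 / 5]. *)
have h1 : (x ^+ 2)^-1 / 4 <= (2 * x * (x + 1))^-1.
  by rewrite -invfM lef_pV2 ?posrE; nra.
have h2 : 21 * x ^+ 2 / a <= (x ^+ 2)^-1 * (21 / 218).
  by rewrite ler_pdivrMr // -mulrA ler_pdivlMl //; lra.
have h3 : 2 / (21 * x ^+ 2) = (x ^+ 2)^-1 * (2 / 21) by field; lra.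
by move: h3 h2 h1 q0 sumle; move: ((x ^+ 2)^-1) (_ / a) ((2 * x * (x + 1))^-1)
  (2 / (21 * x ^+ 2)) (\sum_(_ <= _ < _) _) => *; lra.
Qed.

Lemma counting_fun_not_sparse (R : realType) (S : set nat) (n : nat) :
  Sidon S ->
  is_max [set reciprocal_sum R S' | S' in [set S' | Sidon S']]
         (reciprocal_sum R S) ->
  exists2 m, (n <= m)%N & (m < 8 * counting_fun S m ^ 3)%N.
Proof.
move=> hS hmax; apply: contrapT => sparse.
have {}sparse m : (n < m)%N -> (8 * counting_fun S m ^ 3 <= m)%N.
  move=> nm; rewrite leqNgt; apply/negP => mlt.
  by apply: sparse; exists m => //; exact: ltnW.
(* The cut is made at [n.+1] so that the element 1 is counted even if [n = 0]. *)
have k0 := counting_fun_gt0 S n.+1 (one_in_max _ _ hS hmax) isT.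
set k := counting_fun S n.+1 in k0.
have t0 j : 0 <= tail3 R j by rewrite invr_ge0 !mulr_ge0 ?addr_ge0.
have tk0 : 0 < tail3 R k.
  by rewrite invr_gt0 !mulr_gt0 ?ltr_wpDl ?ltr0n.
suff : tail3 R k <= tail3 R k / 8 by lra.
apply: (tail3_le_of_max R S n.+1 _ hS hmax k0) => X uX XS Xn.
pose f i := (tail3 R (k + i) - tail3 R (k + i).+1) / 8.
have : rsum R X <= \sum_(0 <= i < size X) f i.
  apply: rsum_le_peel_max => // Y y uY YX yY ymax.
  have Y0 : (0 < size Y)%N by case: (Y) yY.
  have ny := Xn _ (YX _ yY).
  have Yb : {in Y, forall x, (n.+1 < x <= y)%N}.
    by move=> z zY; rewrite (ymax z zY) andbT; apply: Xn; apply: YX.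
  have YS : [set` Y] `<=` S by move=> z /YX; apply: XS.
  have := counting_fun_tail S n.+1 y Y (ltnW ny) uY YS Yb.
  have := sparse y (ltnW ny).
  rewrite -/k -{1}(prednK Y0) /f; move: (size Y).-1 => i sy ky.
  have ki0 : (0 < k + i)%N by rewrite addn_gt0 k0.
  rewrite tail3_step // -invfM lef_pV2 ?posrE; last 2 first.
  - by rewrite ltr0n; lia.
  - by rewrite !mulr_gt0 ?ltr_wpDl ?ltr0n.
  have -> : (k + i)%:R * ((k + i)%:R + 1) * ((k + i)%:R + 2) * 8 =
    ((k + i) * (k + i + 1) * (k + i + 2) * 8)%:R :> R.
    by rewrite !natrM !(natrD _ (k + i)).
  rewrite ler_nat; apply: leq_trans sy.
  (* At least [k + i + 1] elements of [S] are at most [y], so sparsity gives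
     [y >= 8 (j + 1)^3 >= 8 j (j + 1) (j + 2)] with [j = k + i]. *)
  apply: (@leq_trans (8 * (k + i).+1 ^ 3)); last first.
    by rewrite leq_mul2l /= leq_exp2r //; lia.
  by rewrite !expnS expn0; move: (k + i)%N => j; nia.
have -> : \sum_(0 <= i < size X) f i = (tail3 R k - tail3 R (k + size X)) / 8.
  elim: (size X) => [|N IH]; first by rewrite big_geq // addn0 subrr mul0r.
  by rewrite big_nat_recr //= IH /f addnS -mulrDl addrA subrK.
by move=> /le_trans; apply; rewrite ler_pM2r // lerBlDr lerDl.
Qed.

Theorem theorem2p1 (R : realType) (S : set nat) (hS : Sidon S)
  (hmax : is_max [set reciprocal_sum R S' | S' in [set S' | Sidon S']]
                 (reciprocal_sum R S)) :
  (exists C : R, 257%:R / 1000%:R < C /\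
     forall n : nat, (0 < n)%N ->
       C * (n%:R : R) `^ (4%:R^-1) < (counting_fun S n)%:R) /\
  (0 < limn_esup (fun n : nat =>
         ((counting_fun S n)%:R / (n%:R : R) `^ (3%:R^-1))%:E))%E.
Proof.
have root (p n : nat) : (0 < p)%N -> ((n%:R : R) `^ (p%:R^-1)) ^+ p = n%:R.
  move=> p0; rewrite -powR_mulrn ?powR_ge0 // -powRrM mulVf ?powRr1 //.
  by rewrite pnatr_eq0 -lt0n.
split.
  exists (13 / 50); split; first by lra.
  move=> n n0; rewrite ltNge; apply/negP => le.
  have := counting_fun_pow4 R S n hS hmax n0.
  rewrite -(ltr_nat R) natrM natrX -(root 4%N n isT).
  apply/negP; rewrite -leNgt.
  move: le (powR_ge0 (n%:R : R) 4%:R^-1) (ler0n R (counting_fun S n)).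
  move: (_ `^ _) (_%:R) => y x xy y0 x0.
  have : x ^+ 4 <= (13 / 50 * y) ^+ 4 by rewrite lerXn2r ?nnegrE //; lra.
  by have := exprn_ge0 4 y0; rewrite exprMn; lra.
rewrite ltNge; apply/negP => le0.
have : (limn_esup (fun n : nat =>
   ((counting_fun S n)%:R / (n%:R : R) `^ (3%:R^-1))%:E) < (1 / 2)%:E)%E.
  by apply: le_lt_trans le0 _; rewrite lte_fin; lra.
(* The upper limit is an infimum of suprema over neighbourhoods [V] of infinity; here [V] contains
   every [m >= N]. Taking [N.+1] below makes [m] positive, so its cube root can be cleared. *)
move=> /ereal_inf_lt[_ [V [N _ NV] <-]] supV.
have [m Nm] := counting_fun_not_sparse R S N.+1 hS hmax.
rewrite -(ltr_nat R) natrM natrX -(root 3%N m isT).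
apply/negP; rewrite -leNgt.
have : (((counting_fun S m)%:R / (m%:R : R) `^ (3%:R^-1))%:E < (1 / 2)%:E)%E.
  apply: le_lt_trans supV; apply: ereal_sup_ubound; exists m => //.
  by apply: NV => /=; lia.
rewrite lte_fin ltr_pdivrMr; last by rewrite powR_gt0 ?ltr0n; lia.
move: (powR_ge0 (m%:R : R) 3%:R^-1) (ler0n R (counting_fun S m)).
move: ((m%:R : R) `^ 3%:R^-1) ((counting_fun S m)%:R : R) => y x y0 x0 xy.
have : x ^+ 3 <= (1 / 2 * y) ^+ 3 by rewrite lerXn2r ?nnegrE //; lra.
by rewrite exprMn; lra.
Qed.
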